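(* Suppose that $X$ is a compact subset of the Euclidean space $\mathbb{R}^{N}$ endowed with a positive Borel measure $\mu$ and let $(T_{n})_{n}$ be a sequence of sublinear and monotone operators from $C(X)$ into itself such that $$\lim_{n\rightarrow\infty}\mu\left(\{x\in X:|T_{n}(f)(x)-f(x)|\geq\varepsilon\}\right)=0$$ for each of the functions $f\in\{1,\ \pm\mathrm{pr}_{1},\ldots,\pm\mathrm{pr}_{N},\ \sum_{k=1}^{N}\mathrm{pr}_{k}^{2}\}$ and each $\varepsilon>0$. Then this convergence (for every $\varepsilon>0$) occurs for all nonnegative functions $f\in C(X)$. It occurs for all functions in $C(X)$ provided that the operators $T_{n}$ are weakly nonlinear and monotone.
   Context: $C(X)$ is the space of all continuous real-valued functions on $X$ with the pointwise ordering. $\mathrm{pr}_{k}$ denotes the $k$-th coordinate function $x=(x_1,\ldots,x_N)\mapsto x_k$ restricted to $X$, and $1$ is the constant function. An operator $T:C(X)\to C(X)$ (not assumed linear) is sublinear if $T(f+g)\leq T(f)+T(g)$ and $T(\alpha f)=\alpha T(f)$ for all $f,g$ and all $\alpha\geq0$; monotone if $f\leq g$ implies $T(f)\leq T(g)$; translatable if $T(f+\alpha\cdot1)=T(f)+\alpha T(1)$ for all $f$ and all $\alpha\geq0$; weakly nonlinear if it is sublinear and translatable. *)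

(* Defs.v *)
From HB Require Import structures.
From mathcomp Require Import all_boot all_order all_algebra.
From mathcomp Require Import all_classical all_reals all_analysis.

Set Implicit Arguments.
Unset Strict Implicit.
Unset Printing Implicit Defensive.

Import Order.TTheory GRing.Theory Num.Theory.
Import numFieldNormedType.Exports.

Local Open Scope classical_set_scope.
Local Open Scope ring_scope.

(* C(S) as a commutative R-algebra for the pointwise operations. When S is
   empty it is the zero ring, whence the possibly trivial ring structure. *)
Section continuous_algebra.
Context {S : topologicalType} {R : realType}.
Implicit Types (f g h : continuousType S R) (a b : R).

Lemma cts_add_subproof f g : continuous (fun x => f x + g x).
Proof. by move=> x; exact: cvgD (@cts_fun _ _ f x) (@cts_fun _ _ g x). Qed.

Lemma cts_opp_subproof f : continuous (fun x => - f x).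
Proof. by move=> x; exact: cvgN (@cts_fun _ _ f x). Qed.

Lemma cts_mul_subproof f g : continuous (fun x => f x * g x).
Proof. by move=> x; exact: cvgM (@cts_fun _ _ f x) (@cts_fun _ _ g x). Qed.

Lemma cts_scale_subproof a f : continuous (fun x => a * f x).
Proof. by move=> x; exact: cvgM (cvg_cst a) (@cts_fun _ _ f x). Qed.

Definition cts_zero : continuousType S R := cst 0.
Definition cts_one : continuousType S R := cst 1.
Definition cts_add f g : continuousType S R := mkcts (@cts_add_subproof f g).
Definition cts_opp f : continuousType S R := mkcts (@cts_opp_subproof f).
Definition cts_mul f g : continuousType S R := mkcts (@cts_mul_subproof f g).
Definition cts_scale a f : continuousType S R :=
  mkcts (@cts_scale_subproof a f).

Lemma cts_addA : associative cts_add.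
Proof. by move=> f g h; apply/continuousEP => x /=; exact: addrA. Qed.

Lemma cts_addC : commutative cts_add.
Proof. by move=> f g; apply/continuousEP => x /=; exact: addrC. Qed.

Lemma cts_add0 : left_id cts_zero cts_add.
Proof. by move=> f; apply/continuousEP => x /=; exact: add0r. Qed.

Lemma cts_addN : left_inverse cts_zero cts_opp cts_add.
Proof. by move=> f; apply/continuousEP => x /=; exact: addNr. Qed.

Lemma cts_mulA : associative cts_mul.
Proof. by move=> f g h; apply/continuousEP => x /=; exact: mulrA. Qed.

Lemma cts_mulC : commutative cts_mul.
Proof. by move=> f g; apply/continuousEP => x /=; exact: mulrC. Qed.

Lemma cts_mul1 : left_id cts_one cts_mul.
Proof. by move=> f; apply/continuousEP => x /=; exact: mul1r. Qed.

Lemma cts_mulDl : left_distributive cts_mul cts_add.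
Proof. by move=> f g h; apply/continuousEP => x /=; exact: mulrDl. Qed.

HB.instance Definition _ := GRing.isZmodule.Build (continuousType S R)
  cts_addA cts_addC cts_add0 cts_addN.

HB.instance Definition _ := GRing.Zmodule_isComPzRing.Build
  (continuousType S R) cts_mulA cts_mulC cts_mul1 cts_mulDl.

Lemma cts_scaleA a b f : cts_scale a (cts_scale b f) = cts_scale (a * b) f.
Proof. by apply/continuousEP => x /=; exact: mulrA. Qed.

Lemma cts_scale1 : left_id 1 cts_scale.
Proof. by move=> f; apply/continuousEP => x /=; exact: mul1r. Qed.

Lemma cts_scaleDr : right_distributive cts_scale +%R.
Proof. by move=> a f g; apply/continuousEP => x /=; exact: mulrDr. Qed.

Lemma cts_scaleDl f : {morph cts_scale^~ f : a b / a + b}.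
Proof. by move=> a b; apply/continuousEP => x /=; exact: mulrDl. Qed.

HB.instance Definition _ := GRing.Zmodule_isLmodule.Build R
  (continuousType S R) cts_scaleA cts_scale1 cts_scaleDr cts_scaleDl.

End continuous_algebra.

Section operators.
Context {S : topologicalType} {R : realType}.
Implicit Types (T : continuousType S R -> continuousType S R).
Implicit Types (f g : continuousType S R).

Definition cts_le f g := forall x, f x <= g x.

Definition sublinear_op T :=
  (forall f g, cts_le (T (f + g)) (T f + T g)) /\
  (forall (a : R) f, 0 <= a -> T (a *: f) = a *: T f).

Definition monotone_op T := forall f g, cts_le f g -> cts_le (T f) (T g).

Definition translatable_op T :=
  forall (a : R) f, 0 <= a ->
    T (f + a *: (1 : continuousType S R)) = T f + a *: T 1.

Definition weakly_nonlinear_op T := sublinear_op T /\ translatable_op T.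

End operators.

Section euclidean.
Context {R : realType} {N : nat} (X : set 'rV[R]_N).

Lemma pr_continuous (k : 'I_N) : continuous (fun x : X => set_val x ord0 k).
Proof.
move=> x; apply: (@continuous_comp _ _ _ set_val (fun v : 'rV[R]_N => v ord0 k)).
  exact: initial_continuous.
exact: coord_continuous.
Qed.

Definition pr (k : 'I_N) : continuousType X R := mkcts (@pr_continuous k).

(* Measurable spaces of the library are pointed, whereas X may be empty: a
   Borel measure on X is given as a Borel measure on R^N evaluated only at
   (the images in R^N of) subsets of X. As X is compact, hence closed, the
   Borel sets of X are exactly the Borel sets of R^N contained in X, so that
   every Borel measure on X is the restriction to X of such a measure, and
   conversely. The topology of 'rV[R]_N is the Euclidean one. *)
Definition borel := g_sigma_algebraType (@open 'rV[R]_N).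

Definition cvg_in_measure (mu : {measure set borel -> \bar R})
    (g : nat -> continuousType X R) (f : continuousType X R) :=
  forall eps : R, 0 < eps ->
    mu (set_val @` [set x : X | eps <= `|g n x - f x|]) @[n --> \oo] --> 0%E.

End euclidean.
Arguments borel : clear implicits.

(* Main.v *)
Require Import Defs.
From mathcomp Require Import all_boot all_order all_algebra.
From mathcomp Require Import all_classical all_reals all_analysis.
From mathcomp Require Import ring lra.
Import Order.TTheory GRing.Theory Num.Theory.
Import numFieldNormedType.Exports.
Local Open Scope classical_set_scope.
Local Open Scope ring_scope.

Set Implicit Arguments.
Unset Strict Implicit.

(** This is Korovkin's argument, carried out pointwise and without linearity.

A continuous function f on a compact set lies, up to an arbitrary d > 0,
between two paraboloids with vertices at any given point x, whose opening c
depends on d but not on x (quadratic_modulus):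
  f x - d - c |s - x|^2 <= f s <= f x + d + c |s - x|^2.
Expanding |s - x|^2 in s, the term -2 x_k s_k has a coefficient of either
sign; having both pr_k and - pr_k among the test functions, one can write
e + c |s - x|^2, with e >= 0, as a combination of the test functions with
nonnegative coefficients (paraboloid), bounded uniformly in x.  On such a
combination sublinearity controls T from above (sublinear_cone_le), so
monotonicity bounds T f x above; the lower bound comes from applying the same
upper bound to f x <= f + (d + c |s - x|^2), which never requires a value
of T at the opposite of a paraboloid.  In both halves f x enters as a
coefficient of the function 1, whence f >= 0.  The outcome (korovkin_estimate)
is
  |T f x - f x| <= d + K * (sum over the test functions t of |T t x - t x|)
with K independent of x and of T.

Such a domination passes to convergence in measure
(cvg_in_measure_dominated): where the left side is at least e = 2 d, one of
finitely many terms on the right is at least a fixed eta, so the bad set of f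
is covered by the bad sets of the test functions.

If the operators are translatable, f is replaced by f + c >= 0, whose error
differs from that of f by c (T 1 - 1). *)

(** * Compactness *)

Lemma compact_set_type (Y : topologicalType) (A : set Y) :
  compact A -> compact [set: A].
Proof.
move=> cA F PF _.
have FA : (set_val @ F) A.
  by apply: (@filterS _ F _ setT); [move=> x _; exact: set_valP|exact: filterT].
have [p [Ap Fp]] := cA _ (fmap_proper_filter _ PF) FA.
exists (exist _ p (mem_set Ap)); split=> // U V FU [_ [[W oW <-] Wp WV]].
have FU' : (set_val @ F) (set_val @` U).
  by apply: (@filterS _ F _ U _ _ FU) => x Ux; exists x.
have [_ [[x Ux <-] Wx]] := Fp _ _ FU' (open_nbhs_nbhs (conj oW Wp)).
by exists x; split => //; exact: WV.
Qed.

(** If g is nonpositive on the zero set of h >= 0, then the open sets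
    {g < d + n h} increase with n and cover the space: at a zero of h because
    g <= 0 < d there, elsewhere for n large.  Compactness gives one n. *)
Lemma compact_le_add_mul (R : realType) (S : topologicalType) (g h : S -> R) :
  compact [set: S] -> continuous g -> continuous h ->
  (forall x, 0 <= h x) -> (forall x, h x = 0 -> g x <= 0) ->
  forall d, 0 < d -> exists2 c, 0 < c & forall x, g x <= d + c * h x.
Proof.
move=> cS cg ch h0 gh0 d d0.
suff [N _ hN] : \forall n \near \oo,
    [set: S] `<=` (fun x => g x <= d + n.+1%:R * h x).
  by exists N.+1%:R => // x; exact: (hN N (leqnn N) x I).
apply: (proj1 (compact_near_coveringP [set: S]) cS) => x _.
have [n hn] : exists n : nat, g x < d + n.+1%:R * h x.
  have [hx0|hx0] := eqVneq (h x) 0.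
    by exists 0%N; rewrite hx0 mulr0 addr0 (le_lt_trans (gh0 _ hx0)).
  have hx : 0 < h x by rewrite lt_neqAle eq_sym hx0 h0.
  exists (Num.truncn `|g x / h x|); rewrite ltr_wpDl ?ltW// -ltr_pdivrMr//.
  by apply: le_lt_trans (ler_norm _) _; exact: truncnS_gt.
have : \forall y \near x, g y < d + n.+1%:R * h y.
  have cu : (fun y => d + n.+1%:R * h y - g y) y @[y --> x] -->
      d + n.+1%:R * h x - g x.
    apply: cvgB; last exact: cg.
    by apply: cvgD; [exact: cvg_cst|apply: cvgMl_tmp; exact: ch].
  have := cvgr_gt _ cu 0; rewrite subr_gt0 => /(_ _ hn).
  by apply: filterS => y; rewrite subr_gt0.
move=> gn; near=> y m => /=.
have gy : g y < d + n.+1%:R * h y by near: y.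
have nm : (n <= m)%N by near: m; exists n.
by rewrite (le_trans (ltW gy))// lerD2l ler_wpM2r// ler_nat.
Unshelve. all: by end_near. Qed.

(** * Sublinear operators on cones *)

Section pointwise.
Context {S : topologicalType} {R : realType}.
Implicit Types (f g : continuousType S R).
Implicit Types (T : continuousType S R -> continuousType S R).

Lemma cts_addE f g x : (f + g) x = f x + g x. Proof. by []. Qed.
Lemma cts_oppE f x : (- f) x = - f x. Proof. by []. Qed.
Lemma cts_scaleE (a : R) f x : (a *: f) x = a * f x. Proof. by []. Qed.
Lemma cts_oneE x : (1 : continuousType S R) x = 1. Proof. by []. Qed.

Lemma cts_sumE (I : Type) (s : seq I) (F : I -> continuousType S R) x :
  (\sum_(i <- s) F i) x = \sum_(i <- s) F i x.
Proof. by elim/big_ind2 : _ => // f a g b <- <-. Qed.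

Lemma sublinear_sum_le T (I : Type) (s : seq I) (a : I -> R)
    (t : I -> continuousType S R) x :
  sublinear_op T -> (forall i, 0 <= a i) ->
  T (\sum_(i <- s) a i *: t i) x <= \sum_(i <- s) a i * T (t i) x.
Proof.
move=> [Tadd Tscale] a0; elim: s => [|i s IH].
  by rewrite !big_nil -(scale0r 0) Tscale// scale0r.
rewrite !big_cons; apply: le_trans (Tadd _ _ _) _.
by rewrite cts_addE Tscale// cts_scaleE lerD2l.
Qed.

(** Sublinearity is one-sided, so the error of T on a combination with
    nonnegative coefficients is bounded from above only. *)
Lemma sublinear_cone_le T (I : finType) (K : R) (a : I -> R)
    (t : I -> continuousType S R) x :
  sublinear_op T -> (forall i, 0 <= a i <= K) ->
  T (\sum_i a i *: t i) x <=
  (\sum_i a i *: t i) x + K * \sum_i `|T (t i) x - t i x|.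
Proof.
move=> sT aK; have a0 i : 0 <= a i by case/andP: (aK i).
apply: le_trans (sublinear_sum_le _ _ _ sT a0) _.
rewrite cts_sumE mulr_sumr -big_split/=; apply: ler_sum => i _.
rewrite cts_scaleE -lerBlDl -mulrBr.
apply: le_trans (ler_wpM2l (a0 i) (ler_norm _)) _.
by apply: ler_wpM2r => //; case/andP: (aK i).
Qed.

End pointwise.

(** * Test functions and paraboloids *)

Section test_functions.
Context {R : realType} {N : nat} (X : set 'rV[R]_N).
Implicit Types (x s : X) (d c : R).

Definition sqnorm : continuousType X R := \sum_k pr X k ^+ 2.

(** The index type is abstract rather than the set of test functions itself
    because these need not be distinct, and coefficients are attached to
    indices. *)
Definition test_fun (i : bool + 'I_N * bool) : continuousType X R :=
  match i with
  | inl true => 1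
  | inl false => sqnorm
  | inr (k, true) => pr X k
  | inr (k, false) => - pr X k
  end.

(** Coefficients of s |-> d + c |s - x|^2.  The coefficient - 2 c x_k of pr_k
    in the expansion is split as 2 c (x_k)^- on pr_k and 2 c (x_k)^+ on - pr_k,
    using 2 t^- = |t| - t and 2 t^+ = |t| + t, to be nonnegative. *)
Definition paraboloid_coef x d c (i : bool + 'I_N * bool) : R :=
  match i with
  | inl true => d + c * sqnorm x
  | inl false => c
  | inr (k, true) => c * (`|pr X k x| - pr X k x)
  | inr (k, false) => c * (`|pr X k x| + pr X k x)
  end.

Definition paraboloid x d c : continuousType X R :=
  \sum_i paraboloid_coef x d c i *: test_fun i.

Lemma sqnormE x : sqnorm x = \sum_k pr X k x ^+ 2.
Proof. by rewrite cts_sumE. Qed.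

Lemma paraboloidE x d c s :
  paraboloid x d c s = d + c * \sum_k (pr X k s - pr X k x) ^+ 2.
Proof.
pose F i := paraboloid_coef x d c i * test_fun i s.
have -> : paraboloid x d c s = \sum_i F i by rewrite /paraboloid cts_sumE.
have pairs : \sum_p F (inr p) =
    \sum_k (c * (`|pr X k x| - pr X k x) * pr X k s +
            c * (`|pr X k x| + pr X k x) * - pr X k s).
  transitivity (\sum_k \sum_b F (inr (k, b))).
    by rewrite pair_bigA; apply: eq_bigr => -[].
  by apply: eq_bigr => k _; rewrite big_bool.
have F1 : F (inl true) = d + c * sqnorm x by exact: mulr1.
have F2 : F (inl false) = c * sqnorm s by [].
rewrite big_sumType big_bool /= F1 F2 pairs !sqnormE -!addrA; congr (_ + _).
rewrite !mulr_sumr -!big_split; apply: eq_bigr => k _ /=.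
set u := mkcts _ x; set v := mkcts _ s; ring.
Qed.

Lemma paraboloid_apex x d c : paraboloid x d c x = d.
Proof.
rewrite paraboloidE big1 ?mulr0 ?addr0// => k _.
by rewrite subrr expr0n.
Qed.

Lemma sqnorm_ge0 x : 0 <= sqnorm x.
Proof. by rewrite sqnormE; apply: sumr_ge0 => k _; exact: sqr_ge0. Qed.

Lemma norm_pr_le k x : `|pr X k x| <= 1 + sqnorm x.
Proof.
apply: (@le_trans _ _ (1 + pr X k x ^+ 2)).
  by rewrite -real_normK ?num_real//; have := sqr_ge0 (`|pr X k x| - 1); nra.
rewrite lerD2l sqnormE (bigD1 k)//= lerDl.
by apply: sumr_ge0 => j _; exact: sqr_ge0.
Qed.

Lemma paraboloid_coef_bound x d c i : 0 <= d -> 0 <= c ->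
  0 <= paraboloid_coef x d c i <= d + 2 * c * (1 + sqnorm x).
Proof.
move=> d0 c0; have q0 := sqnorm_ge0 x.
have cq0 := mulr_ge0 c0 q0.
case: i => [[]|[k b]]; [rewrite /paraboloid_coef; nra..|].
have absle := norm_pr_le k x.
have pos := ler_norm (pr X k x).
have neg := ler_norm (- pr X k x); rewrite normrN in neg.
have scaled t : 0 <= t <= 2 * (1 + sqnorm x) ->
    0 <= c * t <= d + 2 * c * (1 + sqnorm x).
  move=> /andP[t0 tq]; rewrite mulr_ge0//= ler_wpDl//.
  by rewrite (mulrC 2) -mulrA ler_wpM2l.
case: b; [apply: (scaled (`|pr X k x| - pr X k x))|
          apply: (scaled (`|pr X k x| + pr X k x))]; lra.
Qed.

Context (cX : compact X).

(** Compactness is applied on X * X to (x, s) |-> f s - f x and |s - x|^2,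
    the latter vanishing on the diagonal only. *)
Lemma quadratic_modulus (f : continuousType X R) d : 0 < d ->
  exists2 c, 0 < c &
    forall x s, f s <= f x + d + c * \sum_k (pr X k s - pr X k x) ^+ 2.
Proof.
move=> d0.
pose g (p : X * X) := f p.2 - f p.1.
have cfst (u : continuousType X R) : continuous (fun p : X * X => u p.1).
  by move=> p; apply: continuous_comp; [exact: cvg_fst|exact: cts_fun].
have csnd (u : continuousType X R) : continuous (fun p : X * X => u p.2).
  by move=> p; apply: continuous_comp; [exact: cvg_snd|exact: cts_fun].
pose S : topologicalType := (X * X)%type.
pose coord1 k : continuousType S R := mkcts (cfst (pr X k)).
pose coord2 k : continuousType S R := mkcts (csnd (pr X k)).
pose h : continuousType S R := \sum_k (coord2 k - coord1 k) ^+ 2.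
have hE p : h p = \sum_k (pr X k p.2 - pr X k p.1) ^+ 2 by rewrite /h cts_sumE.
have cX2 : compact [set: X * X].
  by rewrite -setXTT; apply: compact_setX; exact: compact_set_type.
have [||||c c0 gh] := @compact_le_add_mul R S g h cX2 _ _ _ _ d d0.
- by move=> p; apply: cvgB; [exact: csnd|exact: cfst].
- exact: cts_fun.
- by move=> p; rewrite hE; apply: sumr_ge0 => k _; exact: sqr_ge0.
- move=> [x s]; rewrite hE => hxs; suff -> : s = x by rewrite /g subrr.
  apply/val_inj/rowP => k; apply/eqP; rewrite -subr_eq0 -sqrf_eq0.
  have /psumr_eq0P : \sum_k (pr X k s - pr X k x) ^+ 2 = 0 by [].
  by move=> /(_ (fun k _ => sqr_ge0 _)) /(_ k isT) /eqP.
exists c => // x s; have := gh (x, s); rewrite hE /g/=.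
by rewrite lerBlDl addrA.
Qed.

(** The case h = 1 of compact_le_add_mul, where the zero set of h is empty. *)
Lemma cts_bounded (f : continuousType X R) :
  exists2 M, 0 < M & forall x, f x <= M.
Proof.
have [//|x /eqP|c c0 hc] := compact_le_add_mul (compact_set_type cX)
  (@cts_fun _ _ f) (@cts_fun _ _ (1 : continuousType X R)) _ _ ltr01.
- by rewrite cts_oneE oner_eq0.
by exists (1 + c) => [|x]; [lra|rewrite -[c]mulr1; exact: hc].
Qed.

(** The constant K is chosen before T and x, which is what lets the estimate be
    used along a sequence of operators and on sets of points. *)
Lemma korovkin_estimate (f : continuousType X R) d : cts_le 0 f -> 0 < d ->
  exists2 K, 0 < K & forall T, sublinear_op T -> monotone_op T ->
    forall x, `|T f x - f x| <=
      d + K * \sum_i `|T (test_fun i) x - test_fun i x|.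
Proof.
move=> f0 d0.
have [c c0 hc] := quadratic_modulus f d0.
have [A A0 hA] := cts_bounded f.
have [B B0 hB] := cts_bounded sqnorm.
(* K bounds the coefficients of every paraboloid of opening c and apex value
   at most A + d. *)
pose K := A + d + 2 * c * (1 + B).
have AK : A + d <= K by rewrite lerDl; nra.
exists (2 * K); first lra.
move=> T sT mT x; set E := \sum_i _.
have E0 : 0 <= E by exact: sumr_ge0.
have par e : 0 <= e <= A + d -> T (paraboloid x e c) x <= e + K * E.
  move=> /andP[e0 eA]; rewrite -[X in X + _](paraboloid_apex x e c).
  apply: sublinear_cone_le => // i.
  have /andP[-> /le_trans->//] := paraboloid_coef_bound x i e0 (ltW c0).
  by rewrite lerD// ler_pM2l ?lerD2l//; lra.
have fx0 : 0 <= f x := f0 x.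
have upper : T f x <= f x + d + K * E.
  apply: le_trans (par _ _); last by rewrite addr_ge0 ?lerD2r ?hA// ltW.
  by apply: mT => s; rewrite paraboloidE.
have lower : f x * T 1 x <= T f x + (d + K * E).
  apply: (@le_trans _ _ (T (f + paraboloid x d c) x)).
    rewrite -cts_scaleE -(proj2 sT)//; apply: mT => s.
    rewrite cts_scaleE cts_oneE mulr1 cts_addE paraboloidE addrA.
    by under eq_bigr do rewrite -sqrrN opprB; exact: hc.
  apply: le_trans (proj1 sT _ _ _) _; rewrite cts_addE lerD2l.
  by apply: par; rewrite ltW//=; lra.
have E1 : `|T 1 x - 1| <= E.
  by rewrite /E (bigD1 (inl true))//= lerDl; exact: sumr_ge0.
(* lower compares T f x with f x * T 1 x; the error of T at 1 makes up for it,
   whence the factor 2 in 2 * K. *)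
have : f x * (1 - T 1 x) <= K * E.
  apply: (@le_trans _ _ (f x * `|T 1 x - 1|)).
    by rewrite ler_wpM2l// distrC ler_norm.
  by apply: ler_pM => //; rewrite (le_trans (hA x))//; lra.
by move=> h; rewrite ler_norml; apply/andP; split; nra.
Qed.

End test_functions.

(** * Convergence in measure *)

Section convergence_in_measure.
Context {R : realType} {N : nat} (X : set 'rV[R]_N).
Context (cX : compact X) (mu : {measure set (borel R N) -> \bar R}).

(** The level set is closed in the compact X, so its image is compact, hence
    closed, in the ambient space. *)
Lemma measurable_level (f g : continuousType X R) (e : R) :
  measurable (set_val @` [set x : X | e <= `|g x - f x|] : set (borel R N)).
Proof.
have cu : continuous (fun x : X => `|g x - f x|).
  by move=> x; exact: (cvg_norm (@cts_fun _ _ (g - f) x)).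
have cl : closed [set x : X | e <= `|g x - f x|].
  apply: (proj1 (continuous_closedP _) cu [set t | e <= t]).
  exact: closed_ge.
have cpt : compact (set_val @` [set x : X | e <= `|g x - f x|]).
  apply: continuous_compact.
    by apply: continuous_subspaceT; exact: initial_continuous.
  exact: subclosed_compact cl (compact_set_type cX) _.
rewrite -[X in measurable X]setCK; apply: measurableC; apply: sub_sigma_algebra.
by apply: closed_openC; apply: compact_closed => //; exact: norm_hausdorff.
Qed.

(** The slack d only has to be smaller than the threshold e: with d = e / 2 the
    sum must account for e / (2 K) on the bad set, so one of its terms is not
    small there. *)
Lemma cvg_in_measure_dominated (I : finType)
    (g : nat -> continuousType X R) (f : continuousType X R)
    (h : I -> nat -> continuousType X R) (l : I -> continuousType X R) :
  (forall i, cvg_in_measure mu (h i) (l i)) ->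
  (forall d, 0 < d -> exists2 K, 0 < K & forall n x,
    `|g n x - f x| <= d + K * \sum_i `|h i n x - l i x|) ->
  cvg_in_measure mu g f.
Proof.
move=> hl dom e e0.
have [K K0 {}dom] := dom (e / 2) (divr_gt0 e0 (ltr0Sn _ _)).
(* The successor gives a strict inequality below, and covers an empty I. *)
pose eta := e / 2 / (K * #|I|.+1%:R).
have eta0 : 0 < eta by rewrite !divr_gt0// mulr_gt0.
pose L i n : set (borel R N) :=
  set_val @` [set x : X | eta <= `|h i n x - l i x|].
have cvgL : (\sum_(k < #|I|) mu (L (enum_val k) n))%E @[n --> \oo] --> 0%E.
  have := @cvg_nnesum _ \oo _ R 'I_#|I| (index_enum _)
    (fun k n => mu (L (enum_val k) n)) (fun=> 0%E) xpredT.
  rewrite [X in _ -> _ -> _ --> X]big1 //; apply => k _; last exact: hl.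
  by apply: nearW => n; exact: measure_ge0.
apply: squeeze_cvge (cvg_cst 0%E) cvgL; apply: nearW => n.
rewrite measure_ge0/=.
(* Subadditivity is stated for sequences indexed by nat, whence the padding by
   the empty set. *)
pose L' k := if insub k is Some k' then L (@enum_val I I k') n else set0.
have L'E (k : 'I_#|I|) : L' k = L (enum_val k) n by rewrite /L' valK.
under eq_bigr do rewrite -L'E.
apply: content_subadditive.
- by move=> k /= kI; rewrite /L' insubT; exact: measurable_level.
- exact: measurable_level.
move=> _ [x /= ex <-]; rewrite -bigcup_mkord.
have [i ei] : exists i, eta <= `|h i n x - l i x|.
  apply/not_existsP => small.
  have : \sum_i `|h i n x - l i x| <= \sum_(i : I) eta.
    by apply: ler_sum => i _; rewrite leNgt; apply/negP => /ltW/small.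
  rewrite sumr_const => le_sum.
  have : K * \sum_i `|h i n x - l i x| < e / 2.
    apply: le_lt_trans (ler_wpM2l (ltW K0) le_sum) _.
    have -> : e / 2 = K * (eta *+ #|I|.+1).
      rewrite -(mulr_natr eta) mulrCA /eta.
      by rewrite divfK// lt0r_neq0// mulr_gt0.
    by rewrite ltr_pM2l// ltr_pMn2l.
  move=> lt_sum; have := dom n x; lra.
exists (enum_rank i) => //=.
by rewrite L'E enum_rankK; exists x.
Qed.

End convergence_in_measure.

Theorem theorem4 (R : realType) (N : nat) (X : set 'rV[R]_N)
  (mu : {measure set (borel R N) -> \bar R})
  (T : nat -> continuousType X R -> continuousType X R) :
  compact X ->
  (forall n, sublinear_op (T n)) ->
  (forall n, monotone_op (T n)) ->
  cvg_in_measure mu (fun n => T n 1) 1 ->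
  (forall k, cvg_in_measure mu (fun n => T n (pr X k)) (pr X k)) ->
  (forall k, cvg_in_measure mu (fun n => T n (- pr X k)) (- pr X k)) ->
  cvg_in_measure mu (fun n => T n (\sum_k pr X k ^+ 2)) (\sum_k pr X k ^+ 2) ->
  (forall f, cts_le 0 f -> cvg_in_measure mu (fun n => T n f) f) /\
  ((forall n, weakly_nonlinear_op (T n)) ->
   forall f, cvg_in_measure mu (fun n => T n f) f).
Proof.
move=> cX sT mT cvg1 cvgpr cvgNpr cvgq.
have pos f : cts_le 0 f -> cvg_in_measure mu (fun n => T n f) f.
  move=> f0; apply: (@cvg_in_measure_dominated _ _ _ cX _ _ _ _
    (fun i n => T n (test_fun X i)) (test_fun X)).
    by move=> [[]|[k []]] /=.
  move=> d d0; have [K K0 hK] := korovkin_estimate cX f0 d0.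
  by exists K => // n x; exact: hK.
split=> // wT f.
have [c c0 hc] := cts_bounded cX (- f).
pose fc : continuousType X R := f + c *: (1 : continuousType X R).
have fc0 : cts_le 0 fc.
  move=> x; rewrite /fc cts_addE cts_scaleE cts_oneE mulr1.
  by have := hc x; rewrite cts_oppE -subr_ge0 opprK addrC.
pose t (b : bool) : continuousType X R := if b then fc else 1.
apply: (@cvg_in_measure_dominated _ _ _ cX _ _ _ _ (fun b n => T n (t b)) t).
  by case; [exact: pos|exact: cvg1].
move=> d d0; exists (1 + c) => [|n x]; first lra.
have -> : \sum_b `|T n (t b) x - t b x| =
    `|T n fc x - fc x| + `|T n 1 x - 1| by rewrite big_bool.
have Tfc : T n fc x = T n f x + c * T n 1 x by rewrite (proj2 (wT n)) // ltW.
have fcx : fc x = f x + c by rewrite /fc cts_addE cts_scaleE cts_oneE mulr1.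
have -> : T n f x - f x = (T n fc x - fc x) - c * (T n 1 x - 1).
  by rewrite Tfc fcx; ring.
apply: le_trans (ler_normB _ _) _; rewrite normrM (gtr0_norm c0).
have := normr_ge0 (T n fc x - fc x); have := normr_ge0 (T n 1 x - 1).
nra.
Qed.
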